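(* For any positive integer $n$ every Hausdorff shift-continuous topology on the semigroup $\mathscr{IPF}(\mathbb{N}^n)$ is discrete.
   Context: $\mathbb{N}$ is the set of positive integers; $(\mathbb{N}^n,\leqslant)$ carries the product (coordinatewise) order; ${\uparrow}\mathbf{x}=\{\mathbf{y}\in\mathbb{N}^n:\mathbf{x}\leqslant\mathbf{y}\}$ is the principal filter generated by $\mathbf{x}$. $\mathscr{IPF}(\mathbb{N}^n)$ is the semigroup of all order isomorphisms between principal filters of $(\mathbb{N}^n,\leqslant)$, with composition of partial maps (maps written on the right, composed left to right, $z(\alpha\beta)=(z\alpha)\beta$ wherever defined). A topology $\tau$ on a semigroup $S$ is shift-continuous if $(S,\tau)$ is a semitopological semigroup, i.e. the semigroup operation is separately continuous (all left and right translations are continuous). *)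

(* Defs.v *)
From HB Require Import structures.
From mathcomp Require Import all_boot all_order.
From mathcomp Require Import all_classical.
From mathcomp Require Import topology.

Set Implicit Arguments.
Unset Strict Implicit.
Unset Printing Implicit Defensive.

Import Order.TTheory.
Local Open Scope classical_set_scope.

Definition posnat := {m : nat | (0 < m)%N}.
HB.instance Definition _ := SubChoice.on posnat.
HB.instance Definition _ := [SubChoice_isSubOrder of posnat by <: with Order.NatOrder.nat_display].

(* The order on a function type is the pointwise one, so [Npow n] carries the
   product order (and is a lattice). *)
Definition Npow (n : nat) := 'I_n -> posnat.
HB.instance Definition _ n := Order.Lattice.on (Npow n).

Definition upfilter {d} {T : porderType d} (x : T) : set T :=
  [set y | (x <= y)%O].

Section PartialMaps.
Context {d : Order.disp_t} {T : porderType d}.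
Implicit Types f g : T -> option T.

(* A partial map of T is a function to [option T], undefined where it is
   [None]; maps act on the right: [z (pcompose f g) = (z f) g]. *)
Definition pdom f : set T := [set x | exists y, f x = Some y].
Definition pran f : set T := [set y | exists x, f x = Some y].
Definition pcompose f g : T -> option T := fun z => obind g (f z).

Record order_iso_between (A B : set T) f : Prop := OrderIsoBetween {
  oib_dom : pdom f = A;
  oib_ran : pran f = B;
  oib_inj : forall x y z, f x = Some z -> f y = Some z -> x = y;
  oib_mono : forall x y x' y', f x = Some x' -> f y = Some y' ->
    (x <= y)%O = (x' <= y')%O }.

Definition filter_iso f : Prop :=
  exists x y : T, order_iso_between (upfilter x) (upfilter y) f.

End PartialMaps.

Lemma pcompose_filter_iso {d} {T : latticeType d} (f g : T -> option T) :
  filter_iso f -> filter_iso g -> filter_iso (pcompose f g).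
Proof.
move=> [x [y [fd fr fi fm]]] [u [v [gd gr gi gm]]].
have [p fp] : exists p, f p = Some (Order.join y u).
  by have : pran f (Order.join y u) by rewrite fr /upfilter /= leUl.
have [q gq] : exists q, g (Order.join y u) = Some q.
  by have : pdom g (Order.join y u) by rewrite gd /upfilter /= leUr.
have ran z z' : f z = Some z' -> (y <= z')%O.
  by move=> fz; have : pran f z' by [exists z]; rewrite fr.
have dom z z' : g z = Some z' -> (u <= z)%O.
  by move=> gz; have : pdom g z by [exists z']; rewrite gd.
have xp : (x <= p)%O.
  have : pdom f p by exists (Order.join y u).
  by rewrite fd.
have vq : (v <= q)%O.
  have : pran g q by exists (Order.join y u).
  by rewrite gr.
have compE z z' : pcompose f g z = Some z' ->
    exists2 w, f z = Some w & g w = Some z'.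
  by rewrite /pcompose; case: (f z) => //= w gw; exists w.
exists p, q; split.
- apply/seteqP; split => z; rewrite /upfilter /=.
  + move=> [z' /compE[w fz gw]].
    by rewrite (fm _ _ _ _ fp fz) leUx (ran _ _ fz) (dom _ _ gw).
  + move=> pz; have [w fz] : pdom f z by rewrite fd; exact: le_trans pz.
    have wge : (u <= w)%O.
      by move: pz; rewrite (fm _ _ _ _ fp fz) leUx => /andP[].
    have [z' gw] : pdom g w by rewrite gd.
    by exists z'; rewrite /pcompose fz.
- apply/seteqP; split => z; rewrite /upfilter /=.
  + move=> [z' /compE[w fz gw]].
    by rewrite -(gm _ _ _ _ gq gw) leUx (ran _ _ fz) (dom _ _ gw).
  + move=> qz; have [w gw] : pran g z by rewrite gr; exact: le_trans qz.
    have wge : (y <= w)%O.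
      by move: qz; rewrite -(gm _ _ _ _ gq gw) leUx => /andP[].
    have [z' fz] : pran f w by rewrite fr.
    by exists z'; rewrite /pcompose fz.
- move=> a b c /compE[w fa gw] /compE[w' fb gw'].
  by move: fb; rewrite -(gi _ _ _ gw gw'); exact: fi.
- move=> a b a' b' /compE[w fa gw] /compE[w' fb gw'].
  by rewrite (fm _ _ _ _ fa fb) (gm _ _ _ _ gw gw').
Qed.

Definition IPF (n : nat) := {f : Npow n -> option (Npow n) | filter_iso f}.
HB.instance Definition _ n := gen_eqMixin (IPF n).
HB.instance Definition _ n := gen_choiceMixin (IPF n).

Definition IPF_mul n (a b : IPF n) : IPF n :=
  exist _ _ (pcompose_filter_iso (proj2_sig a) (proj2_sig b)).

Lemma IPF_mulA n : associative (@IPF_mul n).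
Proof.
move=> [f fP] [g gP] [h hP]; apply: eq_exist => /=.
by apply/funext => z; rewrite /pcompose; case: (f z).
Qed.

HB.instance Definition _ n := isSemigroup.Build (IPF n) (@IPF_mulA n).

(* [Topological T] is the type of topologies on the carrier T; [topologize]
   packs T with one of them, so that the library's notions apply to it. *)
Definition topologize (T : Type) (tau : Topological T) : topologicalType :=
  Topological.Pack tau.

Definition shift_continuous (S : semigroupType) (tau : Topological S) : Prop :=
  forall a : S,
    continuous ((fun x : S => (a * x)%g) : topologize tau -> topologize tau) /\
    continuous ((fun x : S => (x * a)%g) : topologize tau -> topologize tau).

Definition discrete_topological (T : topologicalType) : Prop :=
  @nbhs T T = principal_filter.

(* Main.v *)
(* Given b0, an isomorphism from the filter of p onto the filter of q, consider
   the set U of those b whose domain and range are filters generated by points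
   below p and below q respectively.
   - U is open: the complement of the down-set of p is a finite union of
     principal filters, and b has its domain (range) inside the filter of e iff
     b is fixed by left (right) translation by the identity of that filter; in
     a Hausdorff space the fixed points of a continuous map form a closed set.
   - U is finite: an order isomorphism between two given filters is determined
     by its values on the atoms of its domain, because in N^n a non-minimal
     element that is not an atom is determined by what lies strictly below it.
   A finite open set in a Hausdorff space consists of isolated points. *)
Require Import Defs.
From mathcomp Require Import all_boot all_order.
From mathcomp Require Import all_classical.
From mathcomp Require Import topology.
From mathcomp Require Import zify.

Set Implicit Arguments.
Unset Strict Implicit.
Unset Printing Implicit Defensive.

Import Order.TTheory.
Local Open Scope classical_set_scope.

(** * Fixed points and isolated points in Hausdorff spaces *)

Section Topology.
Context {T : topologicalType}.
Hypothesis T2 : hausdorff_space T.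

(** When [x] is in the closure, any neighbourhoods of [f x] and [x] meet: by continuity some fixed
    point near [x] lies in both. *)
Lemma closed_fixpoints (f : T -> T) : continuous f -> closed [set x | f x = x].
Proof.
move=> fc x clx; apply: T2 => A B Afx Bx.
have fAx : nbhs x (f @^-1` A) by exact: fc.
have [y [/= fy [Ay By]]] := clx _ (filterI fAx Bx).
by exists y; split=> //; rewrite -fy.
Qed.

Lemma locally_finite_discrete :
  (forall x : T, exists U, [/\ open U, finite_set U & U x]) ->
  discrete_topological T.
Proof.
move=> finU; apply/funext => x; apply/funext => A; apply/propext; split.
  by move=> /nbhs_singleton Ax _ ->.
move=> /(_ x erefl) Ax; have [U [oU fU Ux]] := finU x.
(* Finite sets are closed here, so deleting the rest of [U] leaves [x] alone in an open set. *)
have cD : closed (U `\ x).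
  have /accessible_finite_set_closed := hausdorff_accessible T2.
  by apply; exact: finite_setD.
apply: (filterS _ (open_nbhs_nbhs (_ : open_nbhs x (U `&` ~` (U `\ x))))).
  by move=> z [Uz nz]; have [->//|zx] := pselect (z = x); case: nz.
  by split; [apply: openI oU _; rewrite openC | split=> // -[_]; apply].
Qed.
End Topology.

(** * Strict lower sets in the product order *)

Section ProductOrder.
Context {n : nat}.
Implicit Types x y z w t : Npow n.

Lemma Npow_leP x y :
  reflect (forall i, sval (x i) <= sval (y i)) (x <= y)%O.
Proof.
by apply: (iffP (lefP _ _)) => xy i; have := xy i; rewrite leEsub leEnat.
Qed.

Lemma Npow_ltP x y :
  reflect ((x <= y)%O /\ exists i, sval (x i) < sval (y i)) (x < y)%O.
Proof.
rewrite lt_leAnge; apply: (iffP andP) => -[xy].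
  move=> yx; split=> //; apply: contrapT => /forallNP nlt.
  by case/negP: yx; apply/Npow_leP => i; have /negP := nlt i; rewrite -leqNgt.
move=> [i xyi]; split=> //; apply/negP => /Npow_leP/(_ i).
by rewrite leqNgt xyi.
Qed.

Definition Npow_of_pred (v : 'I_n -> nat) : Npow n :=
  fun i => exist _ (v i).+1 isT.

Lemma Npow_of_predK z : Npow_of_pred (fun i => (sval (z i)).-1) = z.
Proof.
by apply/funext => i; apply: val_inj => /=; rewrite prednK //; case: (z i).
Qed.

Lemma Npow_gt0 z i : 0 < sval (z i).
Proof. by case: (z i). Qed.

(* Junk value: the [i]-th coordinate is unchanged if it is already [1]. *)
Definition decr z i : Npow n :=
  Npow_of_pred (fun j => (sval (z j) - (j == i)).-1).

Lemma decrE z i j : 1 < sval (z i) -> sval (decr z i j) = sval (z j) - (j == i).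
Proof.
move=> zi; have := Npow_gt0 z j.
by rewrite /=; case: eqP => [->|_]; lia.
Qed.

Lemma decr_bounds x z i : (x <= z)%O -> sval (x i) < sval (z i) ->
  [/\ (x <= decr z i)%O, (decr z i < z)%O &
      forall j, sval (decr z i j) = sval (z j) - (j == i)].
Proof.
move=> /Npow_leP xz xzi.
(* Coordinates of [x] are at least 1, so the junk case of [decr] does not arise. *)
have zi : 1 < sval (z i) by have := Npow_gt0 x i; lia.
have dE j := decrE j zi; split=> //.
  by apply/Npow_leP => j; rewrite dE; case: eqP => [->|_]; have := xz j; lia.
apply/Npow_ltP; split; first by apply/Npow_leP => j; rewrite dE leq_subr.
by exists i; rewrite dE eqxx; lia.
Qed.

Lemma le_of_strict_down y w w' d :
  (y <= w)%O -> (y <= w')%O ->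
  (forall t, (y <= t)%O -> (t < w)%O = (t < w')%O) ->
  (y < d)%O -> (d < w)%O -> (w <= w')%O.
Proof.
(* If [w i > w' i], then lowering [w] in any coordinate [j != i] would give a
   point below [w] but not below [w'], so [w] exceeds [y] in coordinate [i] only;
   comparing with [w'] lowered at [i] then contradicts [decr w i < w']. *)
move=> yw yw' D yd dw; apply/Npow_leP => i; rewrite leqNgt; apply/negP => w'i.
have /Npow_leP yw'_ := yw'.
have [y_i w_i E_i] := decr_bounds yw (leq_ltn_trans (yw'_ i) w'i).
have yj j : j != i -> sval (w j) <= sval (y j).
  move=> ji; rewrite leqNgt; apply/negP => yj.
  have [y_j w_j E_j] := decr_bounds yw yj.
  move: w_j; rewrite D // => /ltW/Npow_leP/(_ i).
  by rewrite E_j eq_sym (negPf ji); lia.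
have dw' : (d < w')%O by rewrite -D // ltW.
have /Npow_leP d_w := ltW dw; have /Npow_leP d_w' := ltW dw'.
have yi : sval (y i) < sval (d i).
  have /Npow_ltP[_ [j]] := yd; have [->//|/yj] := eqVneq j i.
  by have := d_w j; lia.
have [y'_i w'_i E'_i] := decr_bounds yw' (leq_trans yi (d_w' i)).
move: w'_i; rewrite -D // => /ltW/Npow_leP w'_i.
move: w_i; rewrite D // => /Npow_ltP[_ [k]]; rewrite E_i.
have := w'_i k; rewrite E'_i.
by case: eqP => [->|_]; lia.
Qed.

(** The witness [d] keeps [w] from being [y] or an atom of its filter; distinct atoms have only [y]
    below them in that filter, so they could not be told apart. *)
Lemma strict_down_inj y w w' d :
  (y <= w)%O -> (y <= w')%O ->
  (forall t, (y <= t)%O -> (t < w)%O = (t < w')%O) ->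
  (y < d)%O -> (d < w)%O -> w = w'.
Proof.
move=> yw yw' D yd dw; apply/le_anti/andP; split.
  exact: le_of_strict_down yw yw' D yd dw.
apply: (le_of_strict_down (y := y) (d := d)) => //; last by rewrite -D // ltW.
by move=> t yt; rewrite D.
Qed.

(* Among the points of the filter of [x], these are [x] and the atoms. *)
Definition no_between x z := forall t, (x < t)%O -> ~ (t < z)%O.

(** If [z] exceeded [x] by 2 at [i], lowering it there by 1 would give a point strictly between. *)
Lemma no_between_le x z i : (x <= z)%O -> no_between x z ->
  sval (z i) <= (sval (x i)).+1.
Proof.
move=> xz nb; rewrite leqNgt; apply/negP => zi.
have [xt tz E] := decr_bounds xz (ltnW zi).
apply: nb tz; apply/Npow_ltP; split=> //; exists i.
by rewrite E eqxx; lia.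
Qed.

End ProductOrder.

(** * Order isomorphisms between principal filters *)

Section OrderIso.
Context {d : Order.disp_t} {T : porderType d}.
Implicit Types (f : T -> option T) (x y z w : T).

Lemma order_iso_fun x y f z : order_iso_between (upfilter x) (upfilter y) f ->
  (x <= z)%O -> exists2 w, f z = Some w & (y <= w)%O.
Proof.
move=> [fd fr _ _] xz; have [w fz] : pdom f z by rewrite fd.
by exists w => //; have : pran f w by [exists z]; rewrite fr.
Qed.

Lemma order_iso_surj x y f w : order_iso_between (upfilter x) (upfilter y) f ->
  (y <= w)%O -> exists2 z, f z = Some w & (x <= z)%O.
Proof.
move=> [fd fr _ _] yw; have [z fz] : pran f w by rewrite fr.
by exists z => //; have : pdom f z by [exists w]; rewrite fd.
Qed.

Lemma order_iso_ge x y f z w : order_iso_between (upfilter x) (upfilter y) f ->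
  f z = Some w -> (x <= z)%O /\ (y <= w)%O.
Proof.
move=> [fd fr _ _] fz; split.
  by have : pdom f z by [exists w]; rewrite fd.
by have : pran f w by [exists z]; rewrite fr.
Qed.

Lemma order_iso_None x y f z : order_iso_between (upfilter x) (upfilter y) f ->
  ~~ (x <= z)%O -> f z = None.
Proof.
move=> fP; apply: contraNeq; case E: (f z) => [w|//] _.
by have [] := order_iso_ge fP E.
Qed.

Lemma order_iso_lt x y f z w z' w' :
  order_iso_between (upfilter x) (upfilter y) f ->
  f z = Some w -> f z' = Some w' -> (z < z')%O = (w < w')%O.
Proof.
by move=> [_ _ _ fm] fz fz'; rewrite !lt_leAnge (fm _ _ _ _ fz fz')
  (fm _ _ _ _ fz' fz).
Qed.

Lemma order_iso_bottom x y f : order_iso_between (upfilter x) (upfilter y) f ->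
  f x = Some y.
Proof.
move=> fP; have [w fx yw] := order_iso_fun fP (lexx x).
have [z fz xz] := order_iso_surj fP (lexx y).
rewrite fx; congr Some; apply/le_anti; rewrite yw andbT.
by case: fP => _ _ _ fm; rewrite -(fm _ _ _ _ fx fz).
Qed.

End OrderIso.

(** * Finitely many isomorphisms with bounded generators *)

Section Finiteness.
Context {n : nat}.
Implicit Types (x y z w p q : Npow n) (f g : Npow n -> option (Npow n)).

Lemma order_iso_no_between x y f z w :
  order_iso_between (upfilter x) (upfilter y) f -> f z = Some w ->
  no_between x z -> no_between y w.
Proof.
move=> fP fz nb t yt tw; have fx := order_iso_bottom fP.
have [s fs xs] := order_iso_surj fP (ltW yt).
apply: (nb s); first by rewrite (order_iso_lt fP fx fs).
by rewrite (order_iso_lt fP fs fz).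
Qed.

(** Strong induction on the coordinate sum: once [f] and [g] agree strictly below [z], their values
    at [z] have the same strict lower set in the filter of [y], and [strict_down_inj] applies. *)
Lemma order_iso_ext x y f g :
  order_iso_between (upfilter x) (upfilter y) f ->
  order_iso_between (upfilter x) (upfilter y) g ->
  (forall z, (x <= z)%O -> no_between x z -> f z = g z) -> f = g.
Proof.
move=> fP gP fg; apply/funext => z.
have [m] := ubnP (\sum_i sval (z i)); elim: m z => // m IH z zm.
have [xz|xz] := boolP (x <= z)%O; last first.
  by rewrite (order_iso_None fP xz) (order_iso_None gP xz).
have [/fg->//|] := pselect (no_between x z).
move=> /existsNP[t /not_implyP[xt /contrapT tz]].
have {}IH s : (s < z)%O -> f s = g s.
  move=> /Npow_ltP[/Npow_leP sz [i szi]]; apply: IH.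
  rewrite -ltnS; apply: leq_trans zm.
  rewrite ltnS (bigD1 i) //= [leqRHS](bigD1 i) //=.
  by rewrite -addSn leq_add // leq_sum.
have [w fz yw] := order_iso_fun fP xz.
have [w' gz yw'] := order_iso_fun gP xz.
(* The image of [t] witnesses that [f z] is neither [y] nor an atom. *)
have [u ft yu] := order_iso_fun fP (ltW xt).
rewrite fz gz; congr Some; apply: (strict_down_inj (y := y) (d := u)) => //.
- move=> d yd; apply/idP/idP => [dw|dw'].
    have [s fs xs] := order_iso_surj fP yd.
    have sz : (s < z)%O by rewrite (order_iso_lt fP fs fz).
    by rewrite -(order_iso_lt (z := s) gP _ gz) // -IH.
  have [s gs xs] := order_iso_surj gP yd.
  have sz : (s < z)%O by rewrite (order_iso_lt gP gs gz).
  by rewrite -(order_iso_lt (z := s) fP _ fz) // IH.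
- by rewrite -(order_iso_lt fP (order_iso_bottom fP) ft).
- by rewrite -(order_iso_lt fP ft fz).
Qed.

Definition in_box (M : nat) z := forall i, sval (z i) <= M.

(** The strict bounds leave room in the box for atoms, which exceed the generator by at most 1 in
    each coordinate. Agreement at the least points forces equal generators. *)
Lemma order_iso_box_ext M x y x' y' f g :
  order_iso_between (upfilter x) (upfilter y) f ->
  order_iso_between (upfilter x') (upfilter y') g ->
  (forall i, sval (x i) < M) -> (forall i, sval (y i) < M) ->
  (forall i, sval (x' i) < M) -> (forall i, sval (y' i) < M) ->
  (forall z w, in_box M z -> in_box M w -> (f z = Some w <-> g z = Some w)) ->
  f = g.
Proof.
move=> fP gP xM yM x'M y'M fg.
have fx := order_iso_bottom fP; have gx' := order_iso_bottom gP.
have gx : g x = Some y by apply/fg => // i; exact: ltnW.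
have [x'x y'y] := order_iso_ge gP gx.
have fx' : f x' = Some y' by apply/fg => // i; exact: ltnW.
have [xx' yy'] := order_iso_ge fP fx'.
have ? : x = x' by apply/le_anti; rewrite xx'.
have ? : y = y' by apply/le_anti; rewrite yy'.
subst x' y'; apply: (order_iso_ext (x := x) (y := y)) => // z xz nb.
have [w fz yw] := order_iso_fun fP xz.
rewrite fz; apply/esym/fg => // i.
  exact: leq_trans (no_between_le i xz nb) (xM i).
apply: leq_trans (no_between_le i yw _) (yM i).
exact: order_iso_no_between fP fz nb.
Qed.

(** Indices run from 0 to [M - 1] and [Npow_of_pred] adds 1, which gives exactly the points of the
    box. *)
Definition box_point {M} (b : {ffun 'I_n -> 'I_M}) : Npow n :=
  Npow_of_pred (fun i => b i).

Lemma box_point_surj M z : in_box M z ->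
  exists b : {ffun 'I_n -> 'I_M}, box_point b = z.
Proof.
move=> zM; have zi i : (sval (z i)).-1 < M by rewrite prednK ?Npow_gt0.
exists [ffun i => Ordinal (zi i)]; rewrite -[RHS]Npow_of_predK.
by congr Npow_of_pred; apply/funext => i; rewrite ffunE.
Qed.

Lemma IPF_eq (b c : IPF n) : sval b = sval c -> b = c.
Proof. by case: b c => [f fP] [g gP] /= fg; exact: eq_exist. Qed.

Definition between_low p q : set (IPF n) :=
  [set b | exists x y,
    [/\ order_iso_between (upfilter x) (upfilter y) (sval b),
        (x <= p)%O & (y <= q)%O]].

Lemma finite_between_low p q : finite_set (between_low p q).
Proof.
pose M := (\sum_i (sval (p i) + sval (q i))).+1.
have pM i : sval (p i) < M by rewrite ltnS (bigD1 i) //= -addnA leq_addr.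
have qM i : sval (q i) < M.
  by rewrite ltnS (bigD1 i) //= addnAC addnC leq_addr.
(* The code is the graph of [b] inside the box; it is injective by [order_iso_box_ext]. *)
pose code (b : IPF n) : {set {ffun 'I_n -> 'I_M} * {ffun 'I_n -> 'I_M}} :=
  [set uv | `[< sval b (box_point uv.1) = Some (box_point uv.2) >]]%SET.
suff inj : {in between_low p q &, injective code}.
  apply: card_le_finite (finite_finset (X := code @` between_low p q)).
  by have /card_eqPle[] := inj_card_eq inj.
move=> b c /set_mem[x [y [bP xp yq]]] /set_mem[x' [y' [cP x'p y'q]]] bc.
apply: IPF_eq.
have lt (u v : Npow n) : (u <= v)%O ->
    (forall i, sval (v i) < M) -> forall i, sval (u i) < M.
  by move=> /Npow_leP uv vM i; exact: leq_ltn_trans (uv i) (vM i).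
apply: (@order_iso_box_ext M x y x' y') => //;
  [exact: lt xp _|exact: lt yq _|exact: lt x'p _|exact: lt y'q _|].
move=> z w /box_point_surj[u <-] /box_point_surj[v <-].
have /setP/(_ (u, v)) := bc; rewrite !inE /= => E.
by split=> H; apply/asboolP; [rewrite -E|rewrite E]; apply/asboolP.
Qed.

End Finiteness.

(** * Restriction to filters by translations, and openness *)

Section Retractions.
Context {n : nat}.
Implicit Types (e x y p q : Npow n) (b : IPF n).

Definition pid_above e z : option (Npow n) :=
  if (e <= z)%O then Some z else None.

Lemma filter_iso_pid_above e : filter_iso (pid_above e).
Proof.
have pidE z w : pid_above e z = Some w <-> (e <= z)%O /\ z = w.
  by rewrite /pid_above; case: ifP => ez; split=> [[]|[]] // _ ->.
exists e, e; split.
- by apply/seteqP; split=> [z [w /pidE[]]|z ez] //; exists z; apply/pidE.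
- by apply/seteqP; split=> [w [z /pidE[? <-]]|w ew] //; exists w; apply/pidE.
- by move=> z z' w /pidE[_ ->] /pidE[_ ->].
- by move=> z z' w w' /pidE[_ ->] /pidE[_ ->].
Qed.

Definition IPF_id e : IPF n := exist _ _ (filter_iso_pid_above e).

Lemma mul_IPF_id e b x y :
  order_iso_between (upfilter x) (upfilter y) (sval b) ->
  (IPF_id e * b = b)%g <-> (e <= x)%O.
Proof.
move=> bP; split=> [eb|ex].
  (* The product is defined at the least point [x] only if [e] is below [x]. *)
  have := order_iso_bottom bP; rewrite -{1}eb /= /pcompose /pid_above.
  by case: ifP.
apply/IPF_eq/funext => z /=; rewrite /pcompose /pid_above; case: ifPn => //= ez.
rewrite (order_iso_None bP) //; apply: contra ez; exact: le_trans.
Qed.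

Lemma IPF_mul_id e b x y :
  order_iso_between (upfilter x) (upfilter y) (sval b) ->
  (b * IPF_id e = b)%g <-> (e <= y)%O.
Proof.
move=> bP; split=> [be|ey].
  have bx := order_iso_bottom bP; move: (bx); rewrite -{1}be /=.
  by rewrite /pcompose bx /= /pid_above; case: ifP.
apply/IPF_eq/funext => z /=; rewrite /pcompose; case E: (sval b z) => [w|//] /=.
have [_ yw] := order_iso_ge bP E.
by rewrite /pid_above (le_trans ey yw).
Qed.

(** Its filter is the half-space where coordinate [i] exceeds [p i]; the other coordinates are 1,
    the least value. *)
Definition axis_above p i : Npow n :=
  Npow_of_pred (fun j => if j == i then sval (p i) else 0).

Lemma axis_above_le p i x : (axis_above p i <= x)%O = (sval (p i) < sval (x i)).
Proof.
apply/Npow_leP/idP => [/(_ i)|pxi j]; first by rewrite /= eqxx.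
by rewrite /=; case: eqP => [->//|_]; exact: Npow_gt0.
Qed.

Lemma not_le_axis p x : ~ (x <= p)%O <-> exists i, (axis_above p i <= x)%O.
Proof.
split=> [xp|[i]]; last first.
  by rewrite axis_above_le ltnNge => /negP pxi /Npow_leP.
apply: contrapT => /forallNP H; apply: xp; apply/Npow_leP => i.
by rewrite leqNgt -axis_above_le; exact/negP.
Qed.

Lemma between_lowE p q : between_low p q = ~` \bigcup_i
  ([set b | (IPF_id (axis_above p i) * b = b)%g] `|`
   [set b | (b * IPF_id (axis_above q i) = b)%g]).
Proof.
apply/seteqP; split=> b.
  move=> [x [y [bP xp yq]]] [i _ [/(mul_IPF_id _ bP)|/(IPF_mul_id _ bP)]].
    by move=> ex; case: (not_le_axis p x) => _; apply; [exists i|].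
  by move=> ey; case: (not_le_axis q y) => _; apply; [exists i|].
move=> nb; have [x [y bP]] := svalP b; exists x, y; split=> //.
  apply: contrapT => /not_le_axis[i ex]; apply: nb; exists i => //; left.
  by apply/(mul_IPF_id _ bP).
apply: contrapT => /not_le_axis[i ey]; apply: nb; exists i => //; right.
by apply/(IPF_mul_id _ bP).
Qed.

Lemma open_between_low (tau : Topological (IPF n)) p q :
  hausdorff_space (topologize tau) -> shift_continuous tau ->
  open (between_low p q : set (topologize tau)).
Proof.
move=> T2 sc; rewrite between_lowE openC; apply: closed_bigcup => [|i _].
  exact: finite_finset.
have [lc _] := sc (IPF_id (axis_above p i)).
have [_ rc] := sc (IPF_id (axis_above q i)).
exact: closedU (closed_fixpoints T2 lc) (closed_fixpoints T2 rc).
Qed.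

End Retractions.

Theorem theorem3p1 (n : nat) (n_gt0 : (0 < n)%N)
    (tau : Topological (IPF n)) :
  hausdorff_space (topologize tau) ->
  shift_continuous tau ->
  discrete_topological (topologize tau).
Proof.
move=> T2 sc; apply: locally_finite_discrete => // b.
have [x [y bP]] := svalP b; exists (between_low x y); split.
- exact: open_between_low.
- exact: finite_between_low.
- by exists x, y.
Qed.
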